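(* Let $0 < p < \infty$ and suppose that $(\Omega, \mu)$ is a measure space. Let $W$ be a linear subspace of $L_p(\Omega,\mu)$ that contains linearly independent vectors $u$ and $v$ such that: (1) $\operatorname{supp}(u) \cap \operatorname{supp}(v)$ has positive measure, and (2) $u[v]$ and $v[u]$ are linearly dependent. Then $W$ is virtually degenerate.
   Context: All measures are non-trivial and positive. $L_{p}(\Omega,\mu)$ is real or complex, carries the usual (quasi-)norm, and is assumed to be at least two-dimensional. For measurable functions $u,v$ on $\Omega$, $u[v]=u\cdot\chi_{\operatorname{supp}(v)}$, where $\operatorname{supp}(v)=\{\omega : v(\omega)\neq 0\}$ is the support of $v$ (defined up to null sets). A signed $(s,t)$-simplex in a set $X$ ($s,t>0$ integers) is a collection of (not necessarily distinct) points $x_{1},\ldots,x_{s},y_{1},\ldots,y_{t}\in X$ together with real numbers $m_{1},\ldots,m_{s},n_{1},\ldots,n_{t}$ satisfying $m_{1}+\cdots+m_{s}=n_{1}+\cdots+n_{t}$; it is denoted $D=[x_{j}(m_{j});y_{i}(n_{i})]_{s,t}$. Let $S(D)=\{x_1,\ldots,x_s\}\cup\{y_1,\ldots,y_t\}$. For $z\in S(D)$ put $\mathbf{m}(z)=\sum_{j:x_j=z}m_j$ and $\mathbf{n}(z)=\sum_{i:y_i=z}n_i$ (empty sums are $0$). $D$ is degenerate if $\mathbf{m}(z)=\mathbf{n}(z)$ for all $z\in S(D)$. A non-degenerate signed simplex $D=[x_{j}(m_{j});y_{i}(n_{i})]_{s,t}$ in $L_p(\Omega,\mu)$ is virtually degenerate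 if for $\mu$-almost every $\omega\in\Omega$ the signed simplex $D(\omega)=[x_{j}(\omega)(m_{j});y_{i}(\omega)(n_{i})]_{s,t}$ in the scalar field is degenerate. A linear subspace $W$ is virtually degenerate if there is a virtually degenerate simplex all of whose points lie in $W$. *)

(* Defs.v *)
From HB Require Import structures.
From mathcomp Require Import all_boot all_order all_algebra.
From mathcomp Require Import complex.
From mathcomp Require Import all_classical all_reals all_analysis.
From mathcomp Require Import measurable_realfun.

Set Implicit Arguments.
Unset Strict Implicit.
Unset Printing Implicit Defensive.

Import Order.TTheory GRing.Theory Num.Theory.
Import numFieldNormedType.Exports.

Local Open Scope classical_set_scope.
Local Open Scope ring_scope.

Variant scalar_kind := RealScalars | ComplexScalars.

Definition scalar (R : realType) (k : scalar_kind) : numFieldType :=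
  match k with RealScalars => R | ComplexScalars => R[i] end.

Definition modulus (R : realType) (k : scalar_kind) : scalar R k -> R :=
  match k return scalar R k -> R with
  | RealScalars => fun x : R => `|x|
  | ComplexScalars => fun z : R[i] => complex.Re `|z|
  end.

(* The Borel sigma-algebra of R[i] is that of R * R. *)
Definition measurable_scalar d (Omega : measurableType d) (R : realType)
    (k : scalar_kind) : (Omega -> scalar R k) -> Prop :=
  match k return (Omega -> scalar R k) -> Prop with
  | RealScalars => fun f : Omega -> R => measurable_fun [set: Omega] f
  | ComplexScalars => fun f : Omega -> R[i] =>
      measurable_fun [set: Omega] (@complex.Re R \o f) /\
      measurable_fun [set: Omega] (@complex.Im R \o f)
  end.

Section scalar_theory.
Context (R : realType) (k : scalar_kind).
Implicit Types x y : scalar R k.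

Lemma modulus_ge0 x : 0 <= modulus x.
Proof. by case: k x => [x|[a b]] /=; rewrite ?normr_ge0 ?sqrtr_ge0. Qed.

Lemma modulus0 : modulus (0 : scalar R k) = 0.
Proof.
by case: k; rewrite /modulus; [exact: (@normr0 _ R)|rewrite (@normr0 _ R[i])].
Qed.

Lemma modulus0_eq0 x : modulus x = 0 -> x = 0.
Proof.
case: k x => x; rewrite /modulus; first exact: (@normr0_eq0 _ R).
move=> x0; apply: (@normr0_eq0 _ R[i]).
by rewrite normc_def; case: x x0 => a b /= ->.
Qed.

Lemma modulusM x y : modulus (x * y) = modulus x * modulus y.
Proof.
case: k x y => [x y|x y]; rewrite /modulus; first exact: (@normrM R).
by rewrite (@normrM R[i]); case: x y => [a b] [c e] /=; rewrite !mulr0 subr0.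
Qed.

Lemma modulusD x y : modulus (x + y) <= modulus x + modulus y.
Proof.
case: k x y => [x y|x y]; rewrite /modulus; first exact: (@ler_normD _ R).
have := @ler_normD _ R[i] x y.
by case: x y => [a b] [c e]; rewrite lecE/= => /andP[].
Qed.

Context d (Omega : measurableType d).
Implicit Types f g : Omega -> scalar R k.

Lemma measurable_scalarD f g : measurable_scalar f -> measurable_scalar g ->
  measurable_scalar (fun t => f t + g t).
Proof.
case: k f g => [f g|f g] /=; first exact: measurable_funD.
move=> [f1 f2] [g1 g2]; split.
  apply: (eq_measurable_fun ((@complex.Re R \o f) \+ (@complex.Re R \o g))).
    by move=> t _ /=; case: (f t) (g t) => ? ? [].
  exact: measurable_funD.
apply: (eq_measurable_fun ((@complex.Im R \o f) \+ (@complex.Im R \o g))).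
  by move=> t _ /=; case: (f t) (g t) => ? ? [].
exact: measurable_funD.
Qed.

Lemma measurable_scalarM f g : measurable_scalar f -> measurable_scalar g ->
  measurable_scalar (fun t => f t * g t).
Proof.
case: k f g => [f g|f g] /=; first exact: measurable_funM.
move=> [f1 f2] [g1 g2]; split.
  apply: (eq_measurable_fun (fun t => complex.Re (f t) * complex.Re (g t) -
      complex.Im (f t) * complex.Im (g t))).
    by move=> t _ /=; case: (f t) (g t) => ? ? [].
  by apply: measurable_funB; exact: measurable_funM.
apply: (eq_measurable_fun (fun t => complex.Re (f t) * complex.Im (g t) +
      complex.Im (f t) * complex.Re (g t))).
  by move=> t _ /=; case: (f t) (g t) => ? ? [].
by apply: measurable_funD; exact: measurable_funM.
Qed.

Lemma measurable_scalar_cst (a : scalar R k) :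
  measurable_scalar (fun _ : Omega => a).
Proof. by case: k a => a /=; [|split]; exact: measurable_cst. Qed.

Lemma measurable_modulus f : measurable_scalar f ->
  measurable_fun [set: Omega] (modulus (k:=k) \o f).
Proof.
case: k f => [f|f] /=; first exact: measurableT_comp.
move=> [f1 f2].
apply: (eq_measurable_fun (fun t => Num.sqrt
    (complex.Re (f t) ^+ 2 + complex.Im (f t) ^+ 2))).
  by move=> t _ /=; case: (f t).
apply: (measurableT_comp (f := @Num.sqrt R)); last first.
  by apply: measurable_funD; exact: measurable_funX.
apply: continuous_measurable_fun; exact: sqrt_continuous.
Qed.

End scalar_theory.

(* The L^p types of the library are real-valued and require 1 <= p, so that
   L_p is rebuilt here for all p > 0, over either scalar field: LpFun is the
   space of p-integrable functions and Lp its quotient by the null functions. *)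
Section Lpfun.
Context d (Omega : measurableType d) (R : realType).
Variables (mu : {measure set Omega -> \bar R}) (k : scalar_kind).
Local Notation K := (scalar R k).

Definition Lpfun (p : R) (p0 : 0 < p) : {pred Omega -> K^o} :=
  fun f =>
    `[< measurable_scalar f /\ finite_norm mu p%:E (@modulus R k \o f) >].

Variables (p : R) (p0 : 0 < p).
Implicit Types f g : Omega -> K.

Let integral_modulus f : (finite_norm mu p%:E (@modulus R k \o f)) =
  (\int[mu]_t (modulus (f t) `^ p)%:E < +oo)%E :> Prop.
Proof.
have IE : (\int[mu]_t (modulus (f t) `^ p)%:E =
    'N[mu]_p%:E[EFin \o (@modulus R k \o f)] `^ p)%E.
  rewrite powR_Lnorm ?gt_eqF//; apply: eq_integral => t _ /=.
  by rewrite ger0_norm ?modulus_ge0.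
rewrite IE /finite_norm; apply/propext; split; first exact: poweR_lty.
move=> h; rewrite ltey; apply: contraTneq h => ->.
by rewrite poweRyr ?gt_eqF// ltxx.
Qed.

Let measurable_modulus_powR f : measurable_scalar f ->
  measurable_fun [set: Omega] (fun t => (modulus (f t) `^ p)%:E).
Proof.
move=> mf; apply/measurable_EFinP.
apply: (@measurableT_comp _ _ _ _ _ _ (@powR R ^~ p)) => //.
exact: measurable_modulus.
Qed.

Lemma Lpfun_submod_closed : submod_closed (Lpfun p0).
Proof.
split.
  apply/asboolP; split; first exact: measurable_scalar_cst.
  rewrite integral_modulus; under eq_integral.
    by move=> t _; rewrite [0 t](_ : _ = 0)// modulus0 powR0 ?gt_eqF//; over.
  by rewrite integral0 ltry.
move=> a f g /asboolP[mf If] /asboolP[mg Ig]; apply/asboolP.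
rewrite !integral_modulus in If Ig *.
have mfg : measurable_scalar (a *: f + g).
  apply: (@measurable_scalarD _ k _ _ (fun t => a * f t) g) => //.
  by apply: (@measurable_scalarM _ k) => //; exact: measurable_scalar_cst.
split=> //.
pose c := (2 `^ p : R).
pose F t := (modulus (f t) `^ p); pose G t := (modulus (g t) `^ p).
pose A := c * modulus a `^ p.
have mF : measurable_fun setT (EFin \o F) by exact: measurable_modulus_powR.
have mG : measurable_fun setT (EFin \o G) by exact: measurable_modulus_powR.
have A0 : 0 <= A by rewrite mulr_ge0 ?powR_ge0.
have F0 t : (0 <= (F t)%:E)%E by rewrite lee_fin powR_ge0.
have G0 t : (0 <= (G t)%:E)%E by rewrite lee_fin powR_ge0.
have mAF : measurable_fun setT (fun t => A%:E * (F t)%:E)%E.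
  by apply: emeasurable_funM => //; exact: measurable_cst.
have mcG : measurable_fun setT (fun t => c%:E * (G t)%:E)%E.
  by apply: emeasurable_funM => //; exact: measurable_cst.
have AF0 t : (0 <= A%:E * (F t)%:E)%E by rewrite mule_ge0// lee_fin.
have cG0 t : (0 <= c%:E * (G t)%:E)%E by rewrite mule_ge0// lee_fin powR_ge0.
apply: (@le_lt_trans _ _ (\int[mu]_t (A%:E * (F t)%:E + c%:E * (G t)%:E))%E).
  apply: ge0_le_integral => //.
  - by move=> t _; rewrite lee_fin powR_ge0.
  - exact: measurable_modulus_powR.
  - by apply: emeasurable_funD.
  move=> t _; rewrite -!EFinM -EFinD lee_fin.
  have h : modulus ((a *: f + g) t) <= modulus a * modulus (f t) + modulus (g t).
    by rewrite -modulusM; exact: modulusD.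
  set x := modulus a * modulus (f t) in h; set y := modulus (g t) in h.
  have x0 : 0 <= x by rewrite mulr_ge0 ?modulus_ge0.
  have y0 : 0 <= y by exact: modulus_ge0.
  have -> : A * F t = c * x `^ p by rewrite /A /F powRM ?modulus_ge0// mulrA.
  have le (u v : R) : 0 <= u -> u <= v -> u `^ p <= v `^ p.
    by move=> u0 uv; apply: ge0_ler_powR; rewrite ?nnegrE ?(ltW p0) ?(le_trans u0).
  apply: (le_trans (le _ _ (modulus_ge0 _) h)).
  have [xy|/ltW yx] := leP x y.
    apply: (@le_trans _ _ ((2 * y) `^ p)).
      by apply: le; [rewrite addr_ge0|rewrite mulr_natl mulr2n lerD2r].
    by rewrite powRM// lerDr mulr_ge0 ?powR_ge0.
  apply: (@le_trans _ _ ((2 * x) `^ p)).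
    by apply: le; [rewrite addr_ge0|rewrite mulr_natl mulr2n lerD2l].
  by rewrite powRM// lerDl mulr_ge0 ?powR_ge0.
rewrite ge0_integralD// !ge0_integralZl//= ?lee_fin ?powR_ge0//.
by rewrite lte_add_pinfty// lte_mul_pinfty// ?lee_fin ?powR_ge0.
Qed.

HB.instance Definition _ :=
  GRing.isSubmodClosed.Build K (Omega -> K^o) (Lpfun p0) Lpfun_submod_closed.

Lemma Lpfun_indic f (A : set Omega) : measurable A -> (f : Omega -> K^o) \in Lpfun p0 ->
  (f \* \1_A : Omega -> K^o) \in Lpfun p0.
Proof.
move=> mA /asboolP[mf If]; apply/asboolP.
rewrite !integral_modulus in If *.
have mfA : measurable_scalar (f \* \1_A).
  apply: measurable_scalarM => //.
  have mI : measurable_fun setT (\1_A : Omega -> R) by exact: measurable_indic.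
  clear -mI; case: k => /=; first exact: mI.
  split; [apply: eq_measurable_fun mI|
          apply: eq_measurable_fun (measurable_cst (0 : R))] => t _;
    by rewrite /= /indic; case: (t \in A).
split=> //; apply: le_lt_trans If; apply: ge0_le_integral => //.
- by move=> t _; rewrite lee_fin powR_ge0.
- exact: measurable_modulus_powR.
- exact: measurable_modulus_powR.
move=> t _; rewrite lee_fin /= /indic; case: (t \in A); first by rewrite mulr1.
by rewrite mulr0 modulus0 powR0 ?gt_eqF// powR_ge0.
Qed.

Record LpFun := MkLpFun { Lp_val :> Omega -> K^o ; _ : Lp_val \in Lpfun p0 }.

HB.instance Definition _ := [isSub for Lp_val].
HB.instance Definition _ := [Choice of LpFun by <:].
HB.instance Definition _ := [SubChoice_isSubLmodule of LpFun by <:].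

Definition null_Lpfun : {pred LpFun} :=
  fun u => `[< {ae mu, forall t, u t = 0} >].

Lemma null_Lpfun_submod_closed : submod_closed null_Lpfun.
Proof.
split; first by apply/asboolP; exact: aeW.
move=> a u v /asboolP u0 /asboolP v0; apply/asboolP.
apply: filterS2 u0 v0 => t /= ut vt.
transitivity (a *: u t + v t); first by [].
by rewrite ut vt scaler0 addr0.
Qed.

HB.instance Definition _ :=
  GRing.isSubmodClosed.Build K LpFun null_Lpfun null_Lpfun_submod_closed.

End Lpfun.

Section Lp.
Context d (Omega : measurableType d) (R : realType).
Variables (mu : {measure set Omega -> \bar R}) (k : scalar_kind).
Variables (p : R) (p0 : 0 < p).
Local Notation K := (scalar R k).
Local Open Scope quotient_scope.

Definition Lp : Type := Quotient.quot (@null_Lpfun _ Omega R mu k p p0).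

HB.instance Definition _ := GRing.Zmodule.on Lp.
HB.instance Definition _ := EqQuotient.on Lp.

Definition Lp_scale (a : K) (u : Lp) : Lp := \pi_Lp (a *: repr u).

Definition fun_of_Lp (u : Lp) : Omega -> K := repr u.
Coercion fun_of_Lp : Lp >-> Funclass.

Lemma pi_Lp_eqP (f g : LpFun mu k p0) :
  \pi_Lp f = \pi_Lp g <-> {ae mu, forall t, f t = g t}.
Proof.
have -> : \pi_Lp f = \pi_Lp g <-> (f - g) \in @null_Lpfun _ Omega R mu k p p0.
  by rewrite Quotient.idealrBE; split=> /eqP.
split=> [/asboolP|] fg.
  by apply: filterS fg => t; rewrite [X in X = _ -> _](_ : _ = f t - g t)// => /subr0_eq.
apply/asboolP; apply: filterS fg => t fgt.
by rewrite [LHS](_ : _ = f t - g t)// fgt subrr.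
Qed.

Lemma pi_LpE (f : LpFun mu k p0) : {ae mu, forall t, (\pi_Lp f : Lp) t = f t}.
Proof. by apply/pi_Lp_eqP; rewrite reprK. Qed.

Lemma LpP (u v : Lp) : u = v <-> {ae mu, forall t, u t = v t}.
Proof.
rewrite -[u in X in X <-> _]reprK -[v in X in X <-> _]reprK.
exact: pi_Lp_eqP.
Qed.

Lemma pi_LpD (f g : LpFun mu k p0) :
  (\pi_Lp f : Lp) + (\pi_Lp g : Lp) = \pi_Lp (f + g).
Proof. exact: esym (Quotient.pi_add (@null_Lpfun _ Omega R mu k p p0) f g). Qed.

Lemma pi_LpZ a (f : LpFun mu k p0) : Lp_scale a (\pi_Lp f) = \pi_Lp (a *: f).
Proof.
apply/pi_Lp_eqP; apply: filterS (pi_LpE f) => t ft.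
by rewrite [LHS](_ : _ = a *: (\pi_Lp f : Lp) t)// ft.
Qed.

Lemma Lp_scaleA a b u : Lp_scale a (Lp_scale b u) = Lp_scale (a * b) u.
Proof. by rewrite -[u]reprK !pi_LpZ scalerA !reprK. Qed.

Lemma Lp_scale1 : left_id 1 Lp_scale.
Proof. by move=> u; rewrite -[u]reprK pi_LpZ scale1r !reprK. Qed.

Lemma Lp_scaleDr : right_distributive Lp_scale +%R.
Proof.
by move=> a u v; rewrite -[u]reprK -[v]reprK pi_LpD !pi_LpZ pi_LpD scalerDr.
Qed.

Lemma Lp_scaleDl u : {morph Lp_scale^~ u : a b / a + b}.
Proof. by move=> a b; rewrite -[u]reprK !pi_LpZ pi_LpD scalerDl. Qed.

HB.instance Definition _ := GRing.Zmodule_isLmodule.Build K Lp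
  Lp_scaleA Lp_scale1 Lp_scaleDr Lp_scaleDl.

Lemma LpDE (u v : Lp) : {ae mu, forall t, (u + v : Lp) t = u t + v t}.
Proof.
have -> : u + v = \pi_Lp (repr u + repr v) by rewrite -pi_LpD !reprK.
exact: pi_LpE.
Qed.

Lemma LpZE a (u : Lp) : {ae mu, forall t, (a *: u : Lp) t = a * u t}.
Proof. exact: pi_LpE. Qed.

(* The support is taken on the representative chosen by repr; it is only
   meaningful up to null sets. *)
Definition Lp_support (u : Lp) : set Omega := [set t | u t != 0].

Lemma measurable_Lp_support u : measurable (Lp_support u).
Proof.
have /asboolP[mu_ _] := valP (repr u).
have -> : Lp_support u =
    [set: Omega] `&` ((@modulus R k \o (u : Omega -> K)) @^-1` ~` [set 0]).
  rewrite setTI; apply/seteqP; split=> t /=.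
    move=> /eqP ut /(@modulus0_eq0 R k); exact: ut.
  by move=> ut; apply/eqP => ut0; apply: ut; rewrite ut0 modulus0.
apply: measurable_modulus => //.
exact: measurableC.
Qed.

Lemma Lp_restrict_subproof (u v : Lp) :
  ((u : Omega -> K^o) \* \1_(Lp_support v)) \in Lpfun mu p0.
Proof. exact: Lpfun_indic (measurable_Lp_support v) (valP (repr u)). Qed.

(* The element u[v] = u . chi_(supp v). *)
Definition Lp_restrict (u v : Lp) : Lp :=
  \pi_Lp (MkLpFun (Lp_restrict_subproof u v)).

Lemma Lp_restrictE (u v : Lp) :
  {ae mu, forall t, Lp_restrict u v t = u t * \1_(Lp_support v) t}.
Proof. exact: pi_LpE. Qed.

End Lp.

Definition linearly_dependent (K : fieldType) (V : lmodType K) (u v : V) : Prop :=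
  exists a b : K, (a, b) != (0, 0) /\ a *: u + b *: v = 0.

Record signed_simplex (R : realType) (X : Type) := SignedSimplex {
  ss_s : nat;
  ss_t : nat;
  ss_s_gt0 : (0 < ss_s)%N;
  ss_t_gt0 : (0 < ss_t)%N;
  ss_x : 'I_ss_s -> X;
  ss_y : 'I_ss_t -> X;
  ss_m : 'I_ss_s -> R;
  ss_n : 'I_ss_t -> R;
  ss_balanced : \sum_j ss_m j = \sum_i ss_n i
}.

Definition ss_map (R : realType) (X Y : Type) (h : X -> Y)
    (D : signed_simplex R X) : signed_simplex R Y :=
  SignedSimplex (ss_s_gt0 D) (ss_t_gt0 D) (h \o @ss_x R X D) (h \o @ss_y R X D)
    (ss_balanced D).

Section signed_simplex.
Context (R : realType) (X : eqType).
Implicit Types (D : signed_simplex R X) (z : X).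

Definition ss_points D : set X := range (@ss_x R X D) `|` range (@ss_y R X D).

Definition ss_mweight D z : R := \sum_(j | ss_x (s:=D) j == z) ss_m j.

Definition ss_nweight D z : R := \sum_(i | ss_y (s:=D) i == z) ss_n i.

Definition degenerate D : Prop :=
  forall z, ss_points D z -> ss_mweight D z = ss_nweight D z.

End signed_simplex.

Section virtual_degeneracy.
Context d (Omega : measurableType d) (R : realType).
Context (mu : {measure set Omega -> \bar R}) (k : scalar_kind).
Context (p : R) (p0 : 0 < p).
Local Notation Lp := (Lp mu k p0).

Definition ss_at (D : signed_simplex R Lp) (t : Omega) :
    signed_simplex R (scalar R k) :=
  ss_map (fun u : Lp => u t) D.

Definition virtually_degenerate (D : signed_simplex R Lp) : Prop :=
  ~ degenerate D /\ {ae mu, forall t, degenerate (ss_at D t)}.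

Definition virtually_degenerate_subspace (W : {pred Lp}) : Prop :=
  exists D : signed_simplex R Lp,
    virtually_degenerate D /\ (forall z, ss_points D z -> z \in W).

End virtual_degeneracy.

(* Main.v *)
(** Rescaling [u] and [v] makes them coincide on the intersection of their
    supports, so that almost every pair [(u t, v t)] has the form [(s, s)],
    [(s, 0)] or [(0, s)]. The two triangles [v, u + 2v, 2u] and [u, 2u + v, 2v]
    of an affine hexagon in the plane spanned by [u] and [v] have the same
    projections in each of these three directions. *)
Require Import Defs.
From mathcomp Require Import all_boot all_order all_algebra.
From mathcomp Require Import complex.
From mathcomp Require Import all_classical all_reals all_analysis.

Set Implicit Arguments.
Unset Strict Implicit.
Unset Printing Implicit Defensive.

Import Order.TTheory GRing.Theory Num.Theory.
Import numFieldNormedType.Exports.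

Local Open Scope classical_set_scope.
Local Open Scope ring_scope.

(** Taking any [zmodType] lets one definition serve both in [Lp] and, pointwise, in the scalar
    field. *)
Definition hexagon (R : realType) (V : zmodType) (a b : V) :
    signed_simplex R V :=
  @SignedSimplex R V 3 3 isT isT
    (fun j => [:: b; a + (b + b); a + a]`_j)
    (fun i => [:: a; a + a + b; b + b]`_i)
    (fun _ => 1) (fun _ => 1) erefl.

(** Additivity of [h] is asked only for the four sums that occur: evaluating chosen representatives
    at a point respects a given sum only almost everywhere. *)
Lemma ss_map_hexagon (R : realType) (V V' : zmodType) (h : V -> V') (a b : V) :
    h (a + a) = h a + h a -> h (b + b) = h b + h b ->
    h (a + (b + b)) = h a + h (b + b) -> h (a + a + b) = h (a + a) + h b ->
  ss_map h (hexagon R a b) = hexagon R (h a) (h b).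
Proof.
move=> haa hbb habb haab.
apply: (congr2 (fun x y => @SignedSimplex R V' 3 3 isT isT x y
    (fun _ => 1) (fun _ => 1) erefl)); apply/funext => -[[|[|[|//]]] ?] //=;
  by rewrite ?habb ?haab ?haa ?hbb.
Qed.

(** The two triples of points agree up to order: [b, 3b, 2b] if [a = b], [0, b, 2b] if [a = 0], and
    [0, a, 2a] if [b = 0]. *)
Lemma hexagon_degenerate (R : realType) (V : zmodType) (a b : V) :
  [\/ a = b, a = 0 | b = 0] -> degenerate (hexagon R a b).
Proof.
move=> ab z _; rewrite /ss_mweight /ss_nweight [LHS]big_mkcond [RHS]big_mkcond /=.
rewrite !big_ord_recl !big_ord0 /= !addr0.
case: ab => [->|->|->]; rewrite ?addr0 ?add0r.
- by rewrite (addrA b b b).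
- by rewrite [RHS]addrC -addrA.
- by rewrite [LHS]addrC -addrA.
Qed.

(** The point [b] has weight at least 1 on the first side and 0 on the second: the three hypotheses
    say that [b] differs from [a], [a + a + b] and [b + b]. *)
Lemma hexagon_nondegenerate (R : realType) (V : zmodType) (a b : V) :
  a != b -> a + a != 0 -> b != 0 -> ~ degenerate (hexagon R a b).
Proof.
move=> ab aa0 b0 /(_ b); rewrite /ss_mweight /ss_nweight [LHS]big_mkcond [RHS]big_mkcond /=.
rewrite !big_ord_recl !big_ord0 /= !addr0 eqxx (negbTE ab).
rewrite -[X in _ + _ + b == X]add0r (inj_eq (addIr b)) (negbTE aa0).
rewrite -[X in b + b == X]addr0 (inj_eq (addrI b)) (negbTE b0) !addr0.
have bP : ss_points (hexagon R a b) b by left; exists ord0.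
move=> /(_ bP) /eqP; rewrite gt_eqF// ltr_pwDl//.
by rewrite addr_ge0//; case: ifP.
Qed.

Section Lp_hexagon.
Context (d : measure_display) (Omega : measurableType d) (R : realType).
Context (mu : {measure set Omega -> \bar R}) (k : scalar_kind).
Context (p : R) (p0 : 0 < p).
Implicit Types u v : Lp mu k p0.

Lemma Lp0E : {ae mu, forall t, (0 : Lp mu k p0) t = 0}.
Proof.
have := LpZE 0 (0 : Lp mu k p0); rewrite scale0r.
by apply: filterS => t ->; rewrite mul0r.
Qed.

Lemma hexagon_at u v :
  {ae mu, forall t, ss_at (hexagon R u v) t = hexagon R (u t) (v t)}.
Proof.
have uu := LpDE u u; have vv := LpDE v v.
have uvv := LpDE u (v + v); have uuv := LpDE (u + u) v.
apply: filterS2 (filterI uu vv) (filterI uvv uuv) => t [? ?] [? ?].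
exact: ss_map_hexagon.
Qed.

(** Where [u] and [v] are both nonzero, the two indicator factors equal 1. *)
Lemma Lp_restrict_dep_ae (a b : Defs.scalar R k) u v :
    a *: Lp_restrict u v + b *: Lp_restrict v u = 0 ->
  {ae mu, forall t, u t != 0 -> v t != 0 -> a * u t + b * v t = 0}.
Proof.
move=> /(LpP _ _) uv0.
have sum := LpDE (a *: Lp_restrict u v) (b *: Lp_restrict v u).
have au := LpZE a (Lp_restrict u v); have bv := LpZE b (Lp_restrict v u).
have resu := Lp_restrictE u v; have resv := Lp_restrictE v u.
apply: filterS3 (filterI uv0 sum) (filterI au resu)
  (filterI Lp0E (filterI bv resv)) => t.
move=> [uv0t sumt] [aut resut] [zt [bvt resvt]] ut vt.
move: sumt; rewrite uv0t zt aut bvt resut resvt !indicE !mem_set// !mulr1.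
by move=> <-.
Qed.

(** If one coefficient vanished, evaluating the relation at a point of the common support would make
    the other vanish too. *)
Lemma Lp_restrict_dep_neq0 (a b : Defs.scalar R k) u v :
    (0 < mu (Lp_support u `&` Lp_support v))%E ->
    (a, b) != (0, 0) ->
    a *: Lp_restrict u v + b *: Lp_restrict v u = 0 ->
  a != 0 /\ b != 0.
Proof.
move=> supp_gt0 ab0 /Lp_restrict_dep_ae uv0.
(* Positive measure ensures that an almost everywhere relation is tested at some point of the common
   support. *)
have supp_nonnull : ~ {ae mu, forall t, ~ (u t != 0 /\ v t != 0)}.
  move=> /negligibleP; rewrite (_ : ~` _ = Lp_support u `&` Lp_support v).
    move=> /(_ (measurableI _ _ (measurable_Lp_support u) (measurable_Lp_support v))).
    by move=> supp0; rewrite supp0 ltxx in supp_gt0.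
  by apply/seteqP; split=> t /=; [exact: contrapT | move=> ? /(_ _)].
split; apply/eqP => c0; apply: supp_nonnull; apply: filterS uv0 => t uv0 [ut vt];
  move: (uv0 ut vt) ab0; rewrite c0 mul0r ?add0r ?addr0 => /eqP;
  by rewrite mulf_eq0 ?(negbTE ut) ?(negbTE vt) orbF => /eqP ->; rewrite eqxx.
Qed.

End Lp_hexagon.

Theorem lemma6p4 (d : measure_display) (Omega : measurableType d)
    (R : realType) (mu : {measure set Omega -> \bar R})
    (mu_nontrivial : (0 < mu [set: Omega])%E)
    (k : scalar_kind) (p : R) (p0 : 0 < p)
    (W : {pred Lp mu k p0}) (W_subspace : submod_closed W)
    (u v : Lp mu k p0) (uW : u \in W) (vW : v \in W)
    (uv_indep : ~ linearly_dependent u v)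
    (supp_uv : (0 < mu (Lp_support u `&` Lp_support v))%E)
    (restrict_uv_dep :
      linearly_dependent (Lp_restrict u v) (Lp_restrict v u)) :
  virtually_degenerate_subspace W.
Proof.
case: restrict_uv_dep => a [b [ab0 ab_dep]].
have [a0 b0] := Lp_restrict_dep_neq0 supp_uv ab0 ab_dep.
have indep c e : c *: u + e *: v = 0 -> c = 0 /\ e = 0.
  move=> ce; have [[-> ->]//|ce0] := eqVneq (c, e) (0, 0).
  by case: uv_indep; exists c, e.
have [W0 Wlin] := W_subspace.
have WZ c w : w \in W -> c *: w \in W.
  by move=> wW; rewrite -[_ *: _]addr0 Wlin.
have WD w w' : w \in W -> w' \in W -> w + w' \in W.
  by move=> wW w'W; rewrite -[w]scale1r Wlin.
(* With this scaling, [a * u t + b * v t = 0] becomes equality of [u'] and [v'] at [t]. *)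
pose u' := a *: u; pose v' := - b *: v.
have u'W : u' \in W by exact: WZ.
have v'W : v' \in W by exact: WZ.
exists (hexagon R u' v'); split; last first.
  by move=> z [[[[|[|[|//]]] ?] _ <-]|[[[|[|[|//]]] ?] _ <-]] /=; rewrite ?WD.
split.
  (* Each excluded equality is a linear relation between [u] and [v] with a nonzero coefficient [a],
     [a + a] or [- b]; for [a + a] this uses characteristic zero. *)
  apply: hexagon_nondegenerate.
  - apply/eqP => /eqP; rewrite -subr_eq0 /u' /v' scaleNr opprK => /eqP.
    by move=> /indep[/eqP]; rewrite (negbTE a0).
  - apply/eqP; rewrite /u' -scalerDl -[_ *: u]addr0 -[X in _ + X](scale0r v).
    by move=> /indep[/eqP]; rewrite -mulr2n mulrn_eq0 (negbTE a0).
  - apply/eqP; rewrite /v' -[_ *: v]add0r -[X in X + _](scale0r u).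
    by move=> /indep[_ /eqP]; rewrite oppr_eq0 (negbTE b0).
have au := LpZE a u; have bv := LpZE (- b) v.
have dep := Lp_restrict_dep_ae ab_dep.
apply: filterS2 (hexagon_at u' v') (filterI (filterI au bv) dep).
move=> t -> [[u't v't] uvt]; apply: hexagon_degenerate.
rewrite u't v't.
(* Off either support one value is 0; on both, the dependence makes the values equal. *)
have [->|ut] := eqVneq (u t) 0; first by apply: Or32; rewrite mulr0.
have [->|vt] := eqVneq (v t) 0; first by apply: Or33; rewrite mulr0.
apply: Or31; apply/eqP; rewrite mulNr -addr_eq0.
by apply/eqP; exact: uvt.
Qed.
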